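(* Let $n\le m$, $\theta>0$, and consider a nonzero matrix $\overline{X}\in\mathcal{B}_{1,*}\subset\mathbf{M}^{n\times m}$ along with a singular value decomposition $\overline{X}=\overline{U}(\mathrm{Diag}\,\sigma(\overline{X}))\overline{V}^T$ for orthogonal matrices $\overline{U}\in\mathbf{O}^n$ and $\overline{V}\in\mathbf{O}^m$. Denote by $\bar r$ the rank of $\overline{X}$, let $\widehat{U}$ and $\widehat{V}$ be the restrictions of $\overline{U}$ and $\overline{V}$ to the first $\bar r$ columns, and define $\bar I:=\{(i,j):\overline{X}_{i,j}=0\}$. Then the minimal face $F$ of the ball $\mathcal{B}_{1,*}$ at $\overline{X}$ satisfies $$\frac{\bar r(\bar r+1)-2}{2}-\dim\mathrm{span}\,\big\{\widehat{U}_{i,\cdot}^T\widehat{V}_{j,\cdot}+\widehat{V}_{j,\cdot}^T\widehat{U}_{i,\cdot}:(i,j)\in\bar I\big\}=\dim F.$$ In particular, any face $F$ of the ball $\mathcal{B}_{1,*}$ containing $\overline{X}$ satisfies $$\frac{\bar r(\bar r+1)}{2}-|\bar I|\le \dim F+1.$$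
   Context: $\mathbf{M}^{n\times m}$ is the space of real $n\times m$ matrices. $\sigma(X)=(\sigma_1(X),\dots,\sigma_n(X))$ is the vector of singular values in nonincreasing order, and $\mathrm{Diag}\,\sigma(X)$ is the $n\times m$ matrix with $\sigma(X)$ on its main diagonal and zeros elsewhere. $\|X\|_1=\sum_{i,j}|X_{i,j}|$, $\|X\|_*=\sum_i\sigma_i(X)$, $\|X\|_{1,*}=\|X\|_1+\theta\|X\|_*$, and $\mathcal{B}_{1,*}=\{X\in\mathbf{M}^{n\times m}:\|X\|_{1,*}\le1\}$. $\mathbf{O}^k$ is the group of $k\times k$ orthogonal matrices. $M_{i,\cdot}$ denotes the $i$-th row of $M$ as a row vector, so $\widehat{U}_{i,\cdot}^T\widehat{V}_{j,\cdot}$ is an $\bar r\times\bar r$ matrix. A face of a convex set $Q$ is a convex subset $F\subset Q$ such that every closed segment in $Q$ whose relative interior meets $F$ lies fully in $F$; the minimal face of $Q$ at $\bar x\in Q$ is the face containing $\bar x$ that is contained in every other face containing $\bar x$, equivalently the unique face with $\bar x$ in its relative interior. The dimension of a convex set is the dimension of its affine span.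
   Formalization: The dimension equality is stated only for X̄ on the boundary, ‖X̄‖_{1,*}=1; for ‖X̄‖_{1,*}<1 the minimal face is the whole ball, of dimension nm, and the equality always fails (e.g. n=m=1, θ=1, X̄=1/4: 0≠1). The inequality is kept for every nonzero X̄ in the ball. *)

(* Defs.v *)
From HB Require Import structures.
From mathcomp Require Import all_boot all_order all_algebra.
From mathcomp Require Import polyrcf.
From mathcomp Require Import all_classical reals interval_inference convex.

Set Implicit Arguments.
Unset Strict Implicit.
Unset Printing Implicit Defensive.

Import Order.TTheory GRing.Theory Num.Theory.

Local Open Scope classical_set_scope.
Local Open Scope convex_scope.
Local Open Scope ring_scope.

Section Faces.
Context {R : realType} {E : lmodType R}.
Implicit Types (x y : convex_lmodType E) (Q F : set (convex_lmodType E)).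

Definition segment x y : set (convex_lmodType E) :=
  [set x <| t |> y | t in [set: {i01 R}]].

(* The relative interior of [segment x y]; for x = y it is {x}, as it should
   be. *)
Definition open_segment x y : set (convex_lmodType E) :=
  [set x <| t |> y | t in [set t : {i01 R} | 0 < t%:num < 1]].

Definition face Q F :=
  [/\ convex_set F, F `<=` Q &
      forall x y, segment x y `<=` Q ->
        open_segment x y `&` F !=set0 -> segment x y `<=` F].

Definition minimal_face Q x F :=
  [/\ face Q F, F x & forall G, face Q G -> G x -> F `<=` G].

End Faces.

Section AffineDimension.
Context {R : realType} {E : vectType R}.

Definition affine_span (A : set E) : set E :=
  [set x | exists (k : nat) (a : 'I_k -> R) (p : 'I_k -> E),
     [/\ \sum_(i < k) a i = 1, forall i, A (p i)
       & x = \sum_(i < k) a i *: p i]].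

(* The affine span of a nonempty A is a translate of a unique vector subspace,
   whose dimension this is; for A empty the value 0 is a dummy. *)
Definition affine_dim (A : set E) : nat :=
  xget 0%N [set d | exists (x0 : E) (W : {vspace E}),
    affine_span A = [set x0 + w | w in [set w | w \in W]] /\ \dim W = d].

End AffineDimension.

Section SingularValues.
Context {R : realType}.

(* The real roots of p, each repeated according to its multiplicity. *)
Definition roots_with_mult (p : {poly R}) : seq R :=
  flatten [seq nseq (mup a p) a | a <- rootsR p].

(* The n singular values of an n x m matrix with n <= m: the square roots of
   the eigenvalues of X X^T, with multiplicity, in nonincreasing order. *)
Definition singular_values n m (X : 'M[R]_(n, m)) : 'rV[R]_n :=
  \row_i (sort >=%R
    [seq Num.sqrt a | a <- roots_with_mult (char_poly (X *m X^T))])`_i.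

Definition Diag n m (s : 'rV[R]_n) : 'M[R]_(n, m) :=
  \matrix_(i < n, j < m) (s 0 i *+ (i == j :> nat)).

Definition orthogonal_mx k (A : 'M[R]_k) := A^T *m A = 1%:M.

Definition l1_norm n m (X : 'M[R]_(n, m)) : R := \sum_i \sum_j `|X i j|.

Definition nuclear_norm n m (X : 'M[R]_(n, m)) : R :=
  \sum_i singular_values X 0 i.

Definition l1_nuclear_norm n m (theta : R) (X : 'M[R]_(n, m)) : R :=
  l1_norm X + theta * nuclear_norm X.

Definition l1_nuclear_ball n m (theta : R) : set 'M[R]_(n, m) :=
  [set X | l1_nuclear_norm theta X <= 1].

Definition first_cols n k (le_kn : (k <= n)%N) (A : 'M[R]_n) : 'M[R]_(n, k) :=
  colsub (widen_ord le_kn) A.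

Definition zero_entries n m (X : 'M[R]_(n, m)) : {set 'I_n * 'I_m} :=
  finset (fun ij => X ij.1 ij.2 == 0).

Definition sym_outer n m r (A : 'M[R]_(n, r)) (B : 'M[R]_(m, r))
    (ij : 'I_n * 'I_m) : 'M[R]_r :=
  (row ij.1 A)^T *m row ij.2 B + (row ij.2 B)^T *m row ij.1 A.

End SingularValues.

Arguments l1_nuclear_ball {R} n m theta.
Arguments Diag {R n} m s.

(* Main.v *)
(** Write [X = A Sigma B^T] with [A], [B] the first [r] columns of [U], [V], and
    let [G = sgn X + theta A B^T], a subgradient of the norm at [X]. A matrix [Y]
    satisfies [<Y, G> = |Y|_{1,*}] exactly when [Y = A S B^T] with [S] positive
    semidefinite and [Y] is entrywise zero or of the sign of [X]; when
    [|X|_{1,*} = 1] these [Y] with norm 1 form an exposed face, which contains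
    the minimal one. Conversely, if [S] is symmetric and [D = A S B^T] vanishes
    where [X] does and satisfies [<D, G> = 0], then the norm is constant on
    [X + t D] for small [t], so every face through [X] contains a segment around
    [X] in the direction [D]. Hence the minimal face spans [X + L], where [L] is
    the space of these [D]; its dimension is that of the orthogonal complement
    of the matrices [sym_outer A B ij] and of the symmetric part of [A^T G B] in
    the symmetric matrices, and the latter is independent of the former since it
    is not orthogonal to [Sigma]. *)
Require Import Defs.
From HB Require Import structures.
From mathcomp Require Import all_boot all_order all_algebra.
From mathcomp Require Import complex polyrcf.
From mathcomp Require Import ring lra zify.
From mathcomp Require Import all_classical reals interval_inference convex.

Set Implicit Arguments.
Unset Strict Implicit.
Unset Printing Implicit Defensive.

Import Order.TTheory GRing.Theory Num.Theory.

Local Open Scope ring_scope.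


(** * Spectral theorem for real symmetric matrices *)

Section SymmetricMatrices.
Context {R : rcfType}.

Lemma row_sqr_ge0 n (u : 'rV[R]_n) : 0 <= (u *m u^T) 0 0.
Proof. by rewrite mxE sumr_ge0 // => i _; rewrite mxE -expr2 sqr_ge0. Qed.

Lemma row_sqr_eq0 n (u : 'rV[R]_n) : ((u *m u^T) 0 0 == 0) = (u == 0).
Proof.
apply/eqP/eqP => [|->]; last by rewrite mul0mx mxE.
rewrite mxE => /eqP; rewrite psumr_eq0 => [/allP h|i _]; last first.
  by rewrite mxE -expr2 sqr_ge0.
apply/rowP => i; rewrite mxE; apply/eqP.
by have := h i; rewrite mem_index_enum mxE -expr2 sqrf_eq0; apply.
Qed.

Lemma row_sqr_gt0 n (u : 'rV[R]_n) : u != 0 -> 0 < (u *m u^T) 0 0.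
Proof. by move=> u0; rewrite lt_def row_sqr_ge0 row_sqr_eq0 u0. Qed.

Lemma mul_rowC n (u v : 'rV[R]_n) : (u *m v^T) 0 0 = (v *m u^T) 0 0.
Proof. by rewrite -[u *m _]trmxK trmx_mul trmxK mxE. Qed.

(* Writing a complex eigenpair as [(a + b i, x + y i)], symmetry of [S] gives
   [b (|x|^2 + |y|^2) = 0]. *)
Lemma symmetric_eigenvector n (S : 'M[R]_n.+1) :
  S^T = S -> exists (a : R) (u : 'rV[R]_n.+1), u *m S = a *: u /\ u != 0.
Proof.
move=> symS; pose toC := map_mx (real_complex R).
have [z /eigenvalueP[v vS v0]] := eigenvalue_closed (toC n.+1 n.+1 S) isT.
pose a := complex.Re z; pose b := complex.Im z.
pose x : 'rV[R]_n.+1 := map_mx (@complex.Re R) v.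
pose y : 'rV[R]_n.+1 := map_mx (@complex.Im R) v.
have [xS yS] : x *m S = a *: x - b *: y /\ y *m S = a *: y + b *: x.
  have ReM (c : R[i]) (t : R) : complex.Re (c * t%:C%C) = complex.Re c * t.
    by case: c => c d /=; rewrite mulr0 subr0.
  have ImM (c : R[i]) (t : R) : complex.Im (c * t%:C%C) = complex.Im c * t.
    by case: c => c d /=; rewrite mulr0 add0r.
  have vE j : \sum_k v 0 k * (S k j)%:C%C = z * v 0 j.
    by have /rowP/(_ j) := vS; rewrite !mxE => <-; apply: eq_bigr => k _; rewrite mxE.
  split; apply/rowP => j; rewrite !mxE.
    have := congr1 (@complex.Re R) (vE j).
    rewrite (raddf_sum (@complex.Re R : {additive Rcomplex R -> R})) /=.
    under eq_bigr do rewrite ReM.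
    under [in X in _ -> X]eq_bigr do rewrite !mxE.
    by move=> ->; rewrite /a /b; case: (z) (v 0 j) => [p q] [s t] /=.
  have := congr1 (@complex.Im R) (vE j).
  rewrite (raddf_sum (@complex.Im R : {additive Rcomplex R -> R})) /=.
  under eq_bigr do rewrite ImM.
  under [in X in _ -> X]eq_bigr do rewrite !mxE.
  by move=> ->; rewrite /a /b; case: (z) (v 0 j) => [p q] [s t] /=.
have v_xy : x = 0 -> y = 0 -> False.
  move=> x0 y0; case/eqP: v0; apply/rowP => j.
  move/rowP/(_ j): x0; move/rowP/(_ j): y0; rewrite !mxE.
  by case: (v 0 j) => p q /= -> ->.
have b0 : b = 0.
  have e : (x *m S *m y^T) 0 0 = (y *m S *m x^T) 0 0.
    have -> : x *m S *m y^T = (y *m S *m x^T)^T by rewrite !trmx_mul trmxK symS mulmxA.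
    by rewrite [LHS]mxE.
  have {e} : b * ((x *m x^T) 0 0 + (y *m y^T) 0 0) = 0.
    have addE (A B : 'M[R]_1) : (A + B) 0 0 = A 0 0 + B 0 0 by rewrite mxE.
    have oppE (A : 'M[R]_1) : (- A) 0 0 = - A 0 0 by rewrite mxE.
    have scaleE t (A : 'M[R]_1) : (t *: A) 0 0 = t * A 0 0 by rewrite mxE.
    move: e; rewrite xS yS !mulmxDl !mulNmx -!scalemxAl !addE oppE !scaleE.
    by rewrite (mul_rowC y x); lra.
  move/eqP; rewrite mulf_eq0 => /orP[/eqP//|].
  rewrite paddr_eq0 ?row_sqr_ge0 // !row_sqr_eq0 => /andP[/eqP x0 /eqP y0].
  by case: (v_xy x0 y0).
(* With [b = 0], the real and imaginary parts both satisfy the eigenvector equation for [a], and one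
   of them is nonzero. *)
exists a; have [x0|x0] := eqVneq x 0; last first.
  by exists x; split=> //; rewrite xS b0 scale0r subr0.
exists y; split; first by rewrite yS b0 scale0r addr0.
by apply/eqP => y0; apply: v_xy.
Qed.

(* Householder reflection *)
Lemma orthogonal_first_row n (u : 'rV[R]_n.+1) : (u *m u^T) 0 0 = 1 ->
  exists Q : 'M[R]_n.+1, Q^T *m Q = 1%:M /\ row 0 Q = u.
Proof.
move=> u1; pose e : 'rV[R]_n.+1 := delta_mx 0 0; pose w := u - e.
have [/eqP|w0] := eqVneq w 0.
  rewrite subr_eq0 => /eqP ->; exists 1%:M.
  by rewrite trmx1 mulmx1 row1.
pose s := (w *m w^T) 0 0; have s0 : 0 < s by rewrite row_sqr_gt0.
have ww : w *m w^T = s%:M by apply/rowP => i; rewrite !ord1 [RHS]mxE.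
have ue : (u *m e^T) 0 0 = u 0 0 by rewrite trmx_delta -colE mxE.
have ee : (e *m e^T) 0 0 = 1 by rewrite trmx_delta -colE !mxE.
have sE : s = 2 - 2 * u 0 0.
  rewrite /s /w linearB /= mulmxBr !mulmxBl !mxE.
  move: u1 ue (mul_rowC e u) ee; rewrite !mxE.
  by move=> -> -> -> ->; lra.
(* Hence reflecting [e] in the hyperplane orthogonal to [w] gives [e + w = u]. *)
have ew : e *m w^T = (- (s / 2))%:M.
  apply/rowP => i; rewrite !ord1 [RHS]mxE eqxx mulr1n mul_rowC /w mulmxBl.
  by rewrite [LHS]mxE [X in _ + X]mxE ue ee sE; field.
pose Q := 1%:M - (2 / s) *: (w^T *m w).
exists Q; split.
  have -> : Q^T = Q by rewrite /Q linearB /= linearZ /= trmx_mul trmxK trmx1.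
  rewrite /Q mulmxBr mulmx1 mulmxBl mul1mx -scalemxAl -scalemxAr mulmxA.
  rewrite -[w^T *m w *m w^T]mulmxA ww mul_mx_scalar -scalemxAl !scalerA.
  have -> : 2 / s * (2 / s * s) = 2 / s + 2 / s by field; rewrite gt_eqF.
  by rewrite scalerDl opprB addrK subrK.
rewrite rowE /Q mulmxBr mulmx1 -scalemxAr mulmxA -/e ew mul_scalar_mx scalerA.
have -> : 2 / s * - (s / 2) = -1 by field; rewrite gt_eqF.
by rewrite scaleN1r opprK /w addrC subrK.
Qed.

(** Induction on the size: a unit eigenvector is completed to an orthogonal [Q] with that first row,
    and [Q S Q^T] splits off the eigenvalue as a block. The rows of [P] are the eigenvectors. *)
Lemma symmetric_diagonalization n (S : 'M[R]_n) : S^T = S ->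
  exists (P : 'M[R]_n) (d : 'rV[R]_n),
    P^T *m P = 1%:M /\ S = P^T *m diag_mx d *m P.
Proof.
elim: n S => [|n IHn] S symS.
  by exists 1%:M, 0; split; apply/matrixP => - [].
have [a [u0 [u0S u0n0]]] := symmetric_eigenvector symS.
pose c := Num.sqrt ((u0 *m u0^T) 0 0).
have c0 : 0 < c by rewrite sqrtr_gt0 row_sqr_gt0.
have [Q [QQ Q0]] : exists Q : 'M[R]_n.+1, Q^T *m Q = 1%:M /\ row 0 Q = c^-1 *: u0.
  apply: orthogonal_first_row; rewrite linearZ /= -scalemxAr -scalemxAl !scalerA mxE.
  by rewrite -invfM -expr2 sqr_sqrtr ?row_sqr_ge0 // mulVf // gt_eqF ?row_sqr_gt0.
have QQ' := mulmx1C QQ.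
pose B : 'M[R]_(1 + n) := Q *m S *m Q^T.
have symB : B^T = B by rewrite /B !trmx_mul trmxK symS mulmxA.
have B0 : row 0 B = a *: delta_mx 0 0.
  rewrite /B !row_mul Q0 -scalemxAl u0S scalerA mulrC -scalerA -Q0 -scalemxAl.
  by rewrite -row_mul QQ' row1.
(* Row 0 of [B] is [a] times the first basis vector, and by symmetry so is column 0. *)
have BE : B = block_mx a%:M 0 0 (drsubmx B).
  have Bj j : B 0 j = a *+ (j == 0).
    by have /rowP/(_ j) := B0; rewrite !mxE eqxx /= mulr_natr.
  have Bj' j : B j 0 = a *+ (j == 0) by rewrite -[B]symB mxE Bj.
  rewrite -{1}[B]submxK; congr block_mx; apply/matrixP => i j.
  - rewrite !ord1 2![in LHS]mxE [RHS]mxE eqxx.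
    by rewrite (_ : lshift n 0 = 0) ?Bj ?eqxx //; apply/val_inj.
  - by rewrite !ord1 2![in LHS]mxE [RHS]mxE (_ : lshift n 0 = 0) ?Bj //; apply/val_inj.
  - by rewrite !ord1 2![in LHS]mxE [RHS]mxE (_ : lshift n 0 = 0) ?Bj' //; apply/val_inj.
have symD : (drsubmx B)^T = drsubmx B by rewrite trmx_drsub symB.
have [P [d [PP DE]]] := IHn _ symD.
pose P1 : 'M[R]_(1 + n) := block_mx 1%:M 0 0 P.
have P1P1 : P1^T *m P1 = 1%:M.
  rewrite tr_block_mx mulmx_block !trmx0 trmx1 !mulmx0 !mul0mx mulmx1 !addr0 add0r.
  by rewrite PP -scalar_mx_block.
exists (P1 *m Q), (row_mx (a%:M : 'rV_1) d); split.
  by rewrite trmx_mul mulmxA -[Q^T *m _ *m _]mulmxA P1P1 mulmx1.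
have SB : S = Q^T *m B *m Q.
  by rewrite /B !mulmxA QQ mul1mx -mulmxA QQ mulmx1.
rewrite SB trmx_mul; do 2 rewrite -[in RHS]mulmxA; rewrite -mulmxA; congr (_ *m _).
rewrite !mulmxA; congr (_ *m _).
have dE : diag_mx (row_mx (a%:M : 'rV_1) d) = block_mx a%:M 0 0 (diag_mx d) :> 'M_(1 + n).
  by rewrite diag_mx_row; congr block_mx; apply/rowP => i; rewrite !ord1 !mxE eqxx.
have PE : P1^T *m block_mx a%:M 0 0 (diag_mx d) *m P1
          = block_mx a%:M 0 0 (P^T *m diag_mx d *m P).
  rewrite /P1 tr_block_mx !mulmx_block !trmx0 trmx1.
  by rewrite !(mulmx0, mul0mx, mulmx1, mul1mx, addr0, add0r).
by rewrite BE DE dE; exact: esym PE.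
Qed.
End SymmetricMatrices.

(** * Positive semidefinite matrices, and the nuclear norm as the trace of a square root *)

Section NuclearNorm.
Context {R : realType}.

(** Symmetry is required explicitly: over the reals the quadratic form sees only the symmetric
    part. *)
Definition psdmx n (S : 'M[R]_n) :=
  S^T = S /\ forall p : 'rV_n, 0 <= (p *m S *m p^T) 0 0.

Lemma psd_conj n k (C : 'M[R]_(n, k)) (S : 'M[R]_k) :
  psdmx S -> psdmx (C *m S *m C^T).
Proof.
move=> [symS S0]; split; first by rewrite !trmx_mul trmxK symS mulmxA.
by move=> p; have := S0 (p *m C); rewrite trmx_mul !mulmxA.
Qed.

Lemma psd_comb n (S T : 'M[R]_n) a b :
  0 <= a -> 0 <= b -> psdmx S -> psdmx T -> psdmx (a *: S + b *: T).
Proof.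
move=> a0 b0 [symS S0] [symT T0]; split=> [|p].
  by rewrite linearD /= !linearZ /= symS symT.
rewrite mulmxDr mulmxDl -!scalemxAr -!scalemxAl mxE [X in X + _]mxE [X in _ + X]mxE.
by rewrite addr_ge0 // mulr_ge0.
Qed.

Lemma psd_diag n (d : 'rV[R]_n) : (forall i, 0 <= d 0 i) -> psdmx (diag_mx d).
Proof.
move=> d0; split=> [|p]; first by rewrite tr_diag_mx.
rewrite mxE sumr_ge0 // => i _; rewrite mul_mx_diag !mxE mulrAC -expr2.
by rewrite mulr_ge0 ?sqr_ge0.
Qed.

(** Reads the eigenvalues back from a split characteristic polynomial: the multiplicity of a root of
    the product is its number of occurrences in [s]. *)
Lemma roots_with_mult_prod (s : seq R) :
  perm_eq (roots_with_mult (\prod_(a <- s) ('X - a%:P))) s.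
Proof.
set p := \prod_(a <- s) _.
have p0 : p != 0 by rewrite monic_neq0 // monic_prod_XsubC.
have mupE a : mup a p = count_mem a s.
  rewrite /p; elim: (s) => [|b t IHt].
    by rewrite big_nil mupNroot // /root hornerC oner_eq0.
  rewrite big_cons mupM ?polyXsubC_eq0 ?monic_neq0 ?monic_prod_XsubC // IHt /=.
  by rewrite -['X - _]expr1 mup_XsubCX; case: eqP.
rewrite -(permPr (perm_count_undup s)) /roots_with_mult.
under eq_map do rewrite mupE.
apply/perm_flatten/perm_map/uniq_perm; rewrite ?undup_uniq ?uniq_roots //.
move=> a; rewrite mem_undup; have := roots_on_rootsR p0 a.
by rewrite in_itv /= => <-; rewrite /p root_prod_XsubC.
Qed.

Lemma char_poly_conj n (P D : 'M[R]_n) : P^T *m P = 1%:M ->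
  char_poly (P^T *m D *m P) = char_poly D.
Proof.
move=> PP; rewrite /char_poly.
have PP' : map_mx polyC P^T *m map_mx polyC P = 1%:M by rewrite -map_mxM PP map_mx1.
have -> : char_poly_mx (P^T *m D *m P) =
    map_mx polyC P^T *m char_poly_mx D *m map_mx polyC P.
  rewrite /char_poly_mx mulmxBr mulmxBl -!map_mxM; congr (_ - _).
  by rewrite mul_mx_scalar -scalemxAl PP' scalemx1.
rewrite !det_mulmx mulrAC -det_mulmx PP'.
by rewrite det1 mul1r.
Qed.

Lemma char_poly_diag n (d : 'rV[R]_n) :
  char_poly (diag_mx d) = \prod_(a <- [seq d 0 i | i <- enum 'I_n]) ('X - a%:P).
Proof.
rewrite char_poly_trig ?diag_mx_is_trig // big_map big_enum.
by apply: eq_bigr => i _; rewrite mxE eqxx.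
Qed.

(** The sorted list inside [singular_values] is a permutation of the entries of [b], and the sum
    ignores the order. *)
Lemma nuclear_norm_spectral n m (A : 'M[R]_(n, m)) (P : 'M[R]_n) (b : 'rV[R]_n) :
  P^T *m P = 1%:M -> (forall i, 0 <= b 0 i) ->
  A *m A^T = P^T *m diag_mx (\row_i b 0 i ^+ 2) *m P ->
  nuclear_norm A = \sum_i b 0 i.
Proof.
move=> PP b0 AE; rewrite /nuclear_norm.
rewrite /singular_values AE char_poly_conj // char_poly_diag.
set s := [seq _ | _ <- enum _].
set t := sort _ _.
have tE : perm_eq t [seq b 0 i | i <- enum 'I_n].
  rewrite perm_sort; apply: perm_trans (perm_map _ (roots_with_mult_prod s)) _.
  rewrite (_ : [seq b 0 i | i <- enum 'I_n] = [seq Num.sqrt a | a <- s]) //.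
  by rewrite /s -[RHS]map_comp; apply: eq_map => i /=; rewrite mxE sqrtr_sqr ger0_norm.
have size_t : size t = n by rewrite (perm_size tE) size_map size_enum_ord.
transitivity (\sum_(a <- t) a); last by rewrite (perm_big _ tE) /= big_map big_enum.
rewrite (big_nth 0) size_t big_mkord.
by apply: eq_bigr => i _; rewrite mxE.
Qed.

(** The eigenvalues of the square root [B] of [A A^T] are the singular values of [A]. *)
Lemma nuclear_norm_sqrt n m (A : 'M[R]_(n, m)) (B : 'M[R]_n) :
  psdmx B -> A *m A^T = B *m B -> nuclear_norm A = \tr B.
Proof.
move=> [symB B0] AB; have [P [b [PP BE]]] := symmetric_diagonalization symB.
have PP' := mulmx1C PP.
have trE : \tr B = \sum_i b 0 i.
  by rewrite BE mxtrace_mulC mulmxA PP' mul1mx mxtrace_diag.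
rewrite trE; apply: (nuclear_norm_spectral PP).
  (* The quadratic form of [B] at its eigenvector [row i P] is the eigenvalue [b 0 i]. *)
  move=> i; have := B0 (row i P); rewrite BE !mulmxA -row_mul PP' row1.
  rewrite -mulmxA.
  have -> : P *m (row i P)^T = delta_mx i 0.
    by rewrite -[LHS]trmxK trmx_mul trmxK -row_mul PP' row1 trmx_delta.
  by rewrite -rowE -colE !mxE eqxx.
rewrite AB BE !mulmxA; congr (_ *m _); rewrite -!mulmxA (mulmxA P) PP' mul1mx.
congr (_ *m _); apply/matrixP => i j; rewrite mul_diag_mx !mxE.
by case: eqP => [->|]; rewrite ?mulr0 ?mulr1n ?expr2.
Qed.

End NuclearNorm.

(** * Duality of the nuclear norm with contractions, and the equality case *)

Section NuclearNormDuality.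
Context {R : realType}.

(** The unit ball of the spectral norm, with matrices acting on row vectors. *)
Definition contraction n m (W : 'M[R]_(n, m)) :=
  forall p : 'rV_n, (p *m W *m (p *m W)^T) 0 0 <= (p *m p^T) 0 0.

Lemma mul_row_tr n m (M N : 'M[R]_(n, m)) i :
  (row i M *m (row i N)^T) 0 0 = (M *m N^T) i i.
Proof. by rewrite !mxE; apply: eq_bigr => k _; rewrite !mxE. Qed.

Lemma tr_mul_eq0 n m (D : 'M[R]_(n, m)) : D^T *m D = 0 -> D = 0.
Proof.
move=> D0; apply: trmx_inj; apply/row_matrixP => i; rewrite trmx0 row0.
by apply/eqP; rewrite -row_sqr_eq0 mul_row_tr trmxK D0 mxE.
Qed.

(** The square of [a - s w] is nonnegative and at most [2 s (s - <a, w>)]. For [s > 0] this gives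
    the bound, and equality there makes the square vanish. *)
Lemma row_cauchy_schwarz m (a w : 'rV[R]_m) (s : R) :
  0 <= s -> (a *m a^T) 0 0 = s ^+ 2 -> (w *m w^T) 0 0 <= 1 ->
  (a *m w^T) 0 0 <= s /\ ((a *m w^T) 0 0 = s -> a = s *: w).
Proof.
move=> s0 aa ww.
have [s_eq0|s_neq0] := eqVneq s 0.
  have -> : a = 0 by apply/eqP; rewrite -row_sqr_eq0 aa s_eq0 expr0n.
  by rewrite mul0mx mxE s_eq0 scale0r.
have s_gt0 : 0 < s by rewrite lt_def s_neq0.
have E : ((a - s *: w) *m (a - s *: w)^T) 0 0
    = s ^+ 2 - 2 * s * (a *m w^T) 0 0 + s ^+ 2 * (w *m w^T) 0 0.
  have addE (A B : 'M[R]_1) : (A + B) 0 0 = A 0 0 + B 0 0 by rewrite mxE.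
  have oppE (A : 'M[R]_1) : (- A) 0 0 = - A 0 0 by rewrite mxE.
  have scaleE t (A : 'M[R]_1) : (t *: A) 0 0 = t * A 0 0 by rewrite mxE.
  rewrite mulmxBl [(_ - _)^T]linearB /= linearZ /= !mulmxBr -!scalemxAl -!scalemxAr.
  rewrite !addE !oppE !addE !oppE !scaleE aa (mul_rowC w a); ring.
have := row_sqr_ge0 (a - s *: w); rewrite E => E0.
have sw : s ^+ 2 * (w *m w^T) 0 0 <= s ^+ 2 by rewrite ger_pMr // exprn_gt0.
split; first by rewrite -(ler_pM2l s_gt0); nra.
move=> aw; apply/eqP; rewrite -subr_eq0 -row_sqr_eq0 eq_le row_sqr_ge0 andbT E aw.
nra.
Qed.

(** In an orthonormal eigenbasis [P] of [A A^T] the rows of [P A] have the singular values as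
    lengths, those of [P W] have length at most 1, and the trace is the sum of their pairings, so
    Cauchy-Schwarz applies row by row. [H] is the square root of [A A^T]. *)
Lemma nuclear_norm_dual n m (W A : 'M[R]_(n, m)) : contraction W ->
  \tr (A *m W^T) <= nuclear_norm A /\
  (\tr (A *m W^T) = nuclear_norm A ->
   exists H, [/\ psdmx H, A *m A^T = H *m H & A = H *m W]).
Proof.
move=> cW.
have symAA : (A *m A^T)^T = A *m A^T by rewrite trmx_mul trmxK.
have [P [d [PP AE]]] := symmetric_diagonalization symAA.
have PP' := mulmx1C PP.
have rowP1 i : (row i P *m (row i P)^T) 0 0 = 1.
  by rewrite mul_row_tr PP' mxE eqxx.
have dE i : d 0 i = (row i (P *m A) *m (row i (P *m A))^T) 0 0.
  rewrite mul_row_tr trmx_mul mulmxA -(mulmxA P) AE !mulmxA PP' mul1mx.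
  by rewrite -mulmxA PP' mulmx1 mxE eqxx.
have d0 i : 0 <= d 0 i by rewrite dE row_sqr_ge0.
pose s : 'rV_n := \row_i Num.sqrt (d 0 i).
have s0 i : 0 <= s 0 i by rewrite mxE sqrtr_ge0.
have sE i : s 0 i ^+ 2 = d 0 i by rewrite mxE sqr_sqrtr.
clearbody s.
have nucE : nuclear_norm A = \sum_i s 0 i.
  apply: (nuclear_norm_spectral PP s0); rewrite AE; congr (_ *m diag_mx _ *m _).
  by apply/rowP => i; rewrite mxE sE.
have trE : \tr (A *m W^T) = \sum_i (row i (P *m A) *m (row i (P *m W))^T) 0 0.
  rewrite -[A in LHS]mul1mx -PP -!mulmxA mxtrace_mulC !mulmxA.
  by apply: eq_bigr => i _; rewrite mul_row_tr trmx_mul !mulmxA.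
have CS i := @row_cauchy_schwarz m (row i (P *m A)) (row i (P *m W)) (s 0 i) (s0 i).
have {}CS i : (row i (P *m A) *m (row i (P *m W))^T) 0 0 <= s 0 i /\
  ((row i (P *m A) *m (row i (P *m W))^T) 0 0 = s 0 i ->
  row i (P *m A) = s 0 i *: row i (P *m W)).
  apply: CS; first by rewrite sE dE.
  by rewrite row_mul (le_trans (cW _)) // rowP1.
rewrite trE nucE; split; first by apply: ler_sum => i _; have [] := CS i.
move=> eq_sum.
(* The slacks of the row inequalities are nonnegative and sum to zero, so each row is in the
   equality case. *)
have eq_row i : row i (P *m A) = s 0 i *: row i (P *m W).
  apply: (CS i).2; apply/esym/eqP; rewrite -subr_eq0; apply/eqP.
  move: i (erefl true); apply: psumr_eq0P => [i _|]; first by rewrite subr_ge0 (CS i).1.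
  by rewrite sumrB eq_sum subrr.
exists (P^T *m diag_mx s *m P); split.
- by rewrite -{2}[P]trmxK; apply/psd_conj/psd_diag.
- rewrite AE !mulmxA; congr (_ *m _); rewrite -!mulmxA (mulmxA P) PP' mul1mx.
  congr (_ *m _); apply/matrixP => i j; rewrite mul_diag_mx 2!mxE [in RHS]mxE.
  by case: eqP => [->|]; rewrite ?mulr0 ?mulr1n ?mulr0n // -expr2 sE.
rewrite -!mulmxA; apply: (can_inj (mulKmx (_ : P \in unitmx))).
  by case/mulmx1_unit: PP'.
rewrite (mulmxA P P^T) PP' mul1mx.
apply/row_matrixP => i; rewrite eq_row mul_diag_mx.
by apply/rowP => j; rewrite !mxE.
Qed.

(** The length of [p A B^T] is that of [p A], and [|p|^2 - |p A|^2 = |p - p A A^T|^2]. *)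
Lemma partial_isometry_contraction n m r (A : 'M[R]_(n, r)) (B : 'M[R]_(m, r)) :
  A^T *m A = 1%:M -> B^T *m B = 1%:M -> contraction (A *m B^T).
Proof.
move=> AA BB p.
rewrite trmx_mul trmx_mul trmxK !mulmxA -[p *m A *m _ *m B]mulmxA BB mulmx1.
have := row_sqr_ge0 (p - p *m A *m A^T).
rewrite [(_ - _)^T]linearB /= !trmx_mul trmxK mulmxBr !mulmxBl.
rewrite !mulmxA -[p *m A *m A^T *m A]mulmxA AA mulmx1 subrr subr0.
by rewrite [X in 0 <= X -> _]mxE [X in _ + X]mxE subr_ge0.
Qed.

(** Equality in the duality gives [Y = H A B^T]; it remains to see that the columns of [H] lie in
    the column space of [A]. *)
Lemma nuclear_norm_face n m r (A : 'M[R]_(n, r)) (B : 'M[R]_(m, r)) (Y : 'M[R]_(n, m)) :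
  A^T *m A = 1%:M -> B^T *m B = 1%:M ->
  \tr (Y *m (A *m B^T)^T) = nuclear_norm Y ->
  exists S, psdmx S /\ Y = A *m S *m B^T.
Proof.
move=> AA BB eqY.
have [_ /(_ eqY) [H [psdH YY YH]]] := nuclear_norm_dual Y (partial_isometry_contraction AA BB).
exists (A^T *m H *m A); split; first by rewrite -{2}[A]trmxK; apply: psd_conj.
have symH := psdH.1.
(* [D] is the part of [H] orthogonal to the columns of [A]. Computing [Y Y^T] in two ways gives
   [H H = H A A^T H], that is [D^T D = 0]. *)
pose D := H - A *m A^T *m H.
have D0 : D^T *m D = 0.
  have HH : H *m H = H *m A *m A^T *m H.
    rewrite -YY YH -mulmxA trmx_mul symH trmx_mul trmxK !mulmxA.
    by rewrite -[_ *m B^T *m B]mulmxA BB mulmx1.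
  rewrite /D [(_ - _)^T]linearB /= !trmx_mul trmxK symH mulmxBr !mulmxBl !mulmxA HH subrr.
  by rewrite -[H *m A *m A^T *m A]mulmxA AA mulmx1 subrr subr0.
have HE : H = A *m A^T *m H.
  by apply/eqP; rewrite -subr_eq0; apply/eqP/tr_mul_eq0.
by rewrite YH {1}HE !mulmxA.
Qed.

(** The positive semidefinite square root of [(A S B^T) (A S B^T)^T] is [A S A^T], whose trace is
    that of [S]. *)
Lemma nuclear_norm_embed n m r (A : 'M[R]_(n, r)) (B : 'M[R]_(m, r)) (S : 'M[R]_r) :
  A^T *m A = 1%:M -> B^T *m B = 1%:M -> psdmx S ->
  nuclear_norm (A *m S *m B^T) = \tr S.
Proof.
move=> AA BB psdS.
rewrite (nuclear_norm_sqrt (psd_conj A psdS)).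
  by rewrite mxtrace_mulC mulmxA AA mul1mx.
rewrite !trmx_mul trmxK psdS.1 !mulmxA.
by rewrite -[_ *m B^T *m B]mulmxA BB -[_ *m A^T *m A]mulmxA AA !mulmx1.
Qed.

End NuclearNormDuality.

(** * Affine dimension through direction spaces *)

Section AffineDimension.
Context {R : realType} {E : vectType R}.

(** Makes the direction space of an affine set unique, so that [affine_dim] is determined: every
    vector of [W] is a difference of two points of the translate. *)
Lemma translate_subv (x y : E) (W W' : {vspace E}) :
  [set x + w | w in [set w | w \in W]]%classic =
    [set y + w | w in [set w | w \in W']]%classic -> (W <= W')%VS.
Proof.
move=> eqWW'.
have sub w : w \in W -> x + w - y \in W'.
  move=> wW; have : [set y + w | w in [set w | w \in W']]%classic (x + w).
    by rewrite -eqWW'; exists w.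
  by case=> w' /= w'W' <-; rewrite addrC addKr.
apply/subvP => w wW; have -> : w = (x + w - y) - (x + 0 - y).
  by rewrite addr0 opprB addrA subrK addrC addKr.
by rewrite memvB ?sub ?mem0v.
Qed.

Lemma affine_dim_translate (A : set E) x (W : {vspace E}) :
  affine_span A = [set x + w | w in [set w | w \in W]]%classic ->
  affine_dim A = \dim W.
Proof.
move=> AW; apply: xget_unique; first by exists x, W.
move=> d [y [W' [AW' <-]]]; congr (\dim _); apply/eqP; rewrite eqEsubv.
by rewrite (@translate_subv y x) -?AW -?AW' // (@translate_subv x y) -?AW -?AW'.
Qed.

(** [W] is the span of all differences [a - x]. It is obtained as the span of a finite list of such
    differences whose dimension is maximal. *)
Lemma affine_dim_directions (A : set E) x : A x ->
  exists W : {vspace E}, [/\ affine_dim A = \dim W,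
    forall a, A a -> a - x \in W
  & forall W' : {vspace E}, (forall a, A a -> a - x \in W') -> (W <= W')%VS].
Proof.
move=> Ax; pose P k := `[< exists s : seq E,
  (forall v, v \in s -> A (x + v)) /\ \dim <<s>>%VS = k >].
have exP : exists k, P k.
  by exists 0%N; apply/asboolP; exists [::]; split => //; rewrite span_nil dimv0.
have ubP k : P k -> (k <= \dim (@fullv _ E))%N.
  by move/asboolP => [s [_ <-]]; rewrite dimvS ?subvf.
case: (ex_maxnP exP ubP) => _ /asboolP[s [sA <-]] smax.
have AW a : A a -> a - x \in <<s>>%VS.
  (* Adding [a - x] to the list cannot raise the maximal dimension, so it already lies in the
     span. *)
  move=> Aa; have : P (\dim <<a - x :: s>>%VS).
    apply/asboolP; exists (a - x :: s); split => // v.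
    by rewrite inE => /orP[/eqP ->|/sA//]; rewrite addrC subrK.
  move/smax => le_dim; have sub : (<<s>> <= <<a - x :: s>>)%VS.
    by rewrite span_cons addvSr.
  have /eqP -> : <<s>>%VS == <<a - x :: s>>%VS by rewrite eqEdim sub.
  by rewrite memv_span ?mem_head.
exists <<s>>%VS; split => //; last first.
  by move=> W' AW'; apply/span_subvP => v /sA/AW'; rewrite addrC addKr.
apply: (@affine_dim_translate _ x); apply/seteqP; split => y.
  move=> [k [a [p [a1 Ap ->]]]]; exists (\sum_i a i *: p i - x); last by rewrite addrC subrK.
  rewrite /= -{1}[x]scale1r -a1 scaler_suml -sumrB memv_suml // => i _.
  by rewrite -scalerBr memvZ ?AW.
move=> [w /= ws <-]; pose c i := coord (in_tuple s) i w; pose t := \sum_i c i.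
(* The point [x + s_j] gets the coordinate [c j] of [w] as weight, and [x] gets the rest, so that
   the weights sum to 1. *)
exists (size s).+1, (fun i => oapp c (1 - t) (unlift ord0 i)),
  (fun i => oapp (fun j : 'I_(size s) => x + s`_j) x (unlift ord0 i)); split.
- rewrite big_ord_recl unlift_none /=.
  under eq_bigr => i _ do rewrite liftK.
  by rewrite subrK.
- by move=> i; case: unliftP => [j _|_] //=; apply: sA; rewrite mem_nth.
rewrite big_ord_recl unlift_none /=.
under eq_bigr => i _ do rewrite liftK /= scalerDr.
rewrite big_split /= -scaler_suml -/t addrA -scalerDl subrK scale1r.
by rewrite [w in LHS](coord_span (X := in_tuple s)).
Qed.

End AffineDimension.

(** * The space of symmetric matrices and orthogonal complements for the trace form *)

Section SymmetricSpace.
Context {R : realType}.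

Lemma mxtrace_sqr_eq0 n m (S : 'M[R]_(n, m)) : \tr (S *m S^T) = 0 -> S = 0.
Proof.
move=> S0; apply/row_matrixP => i; rewrite row0; apply/eqP.
rewrite -row_sqr_eq0 mul_row_tr; apply/eqP; move: i (erefl true).
by apply: psumr_eq0P => // i _; rewrite -mul_row_tr row_sqr_ge0.
Qed.

Definition frobenius_coords r k (X : k.-tuple 'M[R]_r) (S : 'M[R]_r) : 'rV[R]_k :=
  \row_i \tr (S *m (X`_i)^T).

Fact frobenius_coords_is_linear r k (X : k.-tuple 'M[R]_r) :
  linear (frobenius_coords X).
Proof.
by move=> a A B; apply/rowP => i; rewrite !mxE mulmxDl -scalemxAl mxtraceD mxtraceZ.
Qed.
HB.instance Definition _ r k (X : k.-tuple 'M[R]_r) :=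
  GRing.isLinear.Build R _ _ _ _ (frobenius_coords_is_linear X).

(** Not the usual skew part, which vanishes on symmetric matrices: this map sends the symmetric
    matrices onto the skew ones, with the diagonal matrices as kernel. *)
Definition skew_part r (S : 'M[R]_r) : 'M[R]_r :=
  \matrix_(i, j) (S i j *+ (j < i)%N - S i j *+ (i < j)%N).

Fact skew_part_is_linear r : linear (@skew_part r).
Proof.
move=> a A B; apply/matrixP => i j; rewrite !mxE.
by case: ltngtP => _; rewrite ?(mulr0n, mulr1n); ring.
Qed.
HB.instance Definition _ r :=
  GRing.isLinear.Build R _ _ _ _ (@skew_part_is_linear r).

(** Without the factor 1/2, so that [sym_outer] is literally a value of it. *)
Definition double_sym_part r (S : 'M[R]_r) : 'M[R]_r := S + S^T.

Fact double_sym_part_is_linear r : linear (@double_sym_part r).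
Proof.
by move=> a A B; rewrite /double_sym_part linearP scalerDr addrACA.
Qed.
HB.instance Definition _ r :=
  GRing.isLinear.Build R _ _ _ _ (@double_sym_part_is_linear r).

Definition symv r : {vspace 'M[R]_r} := limg (linfun (@double_sym_part r)).

Lemma symvP r (S : 'M[R]_r) : reflect (S^T = S) (S \in symv r).
Proof.
apply: (iffP idP) => [/memv_imgP[A _ ->]|symS].
  by rewrite lfunE /= /double_sym_part linearD /= trmxK addrC.
apply/memv_imgP; exists (2^-1 *: S); rewrite ?memvf // lfunE /= /double_sym_part.
by rewrite linearZ /= symS -scalerDl -{1}[S]scale1r; congr (_ *: _); field.
Qed.

(** Rank-nullity twice: [double_sym_part] gives skew + sym = r^2, and [skew_part] on the symmetric
    matrices gives r + skew = sym. *)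
Lemma dim_symv r : (\dim (symv r)).*2 = (r * r.+1)%N.
Proof.
pose skewv := lker (linfun (@double_sym_part r)).
have skewP K : reflect (K^T = - K) (K \in skewv).
  rewrite memv_ker lfunE /= /double_sym_part addrC addr_eq0; exact: eqP.
have dims : (\dim skewv + \dim (symv r) = r * r)%N.
  by have := limg_ker_dim (linfun (@double_sym_part r)) fullv; rewrite capfv dimvf /dim /=.
pose L := linfun (@skew_part r).
have img : (L @: symv r)%VS = skewv.
  apply/vspaceP => K; apply/memv_imgP/skewP => [[S /symvP symS ->]|skewK].
    apply/matrixP => i j; rewrite lfunE !mxE -{1 2}symS !mxE.
    by case: ltngtP => _; rewrite ?(mulr0n, mulr1n); ring.
  have Kij i j : K j i = - K i j by move/matrixP/(_ i j): skewK; rewrite !mxE.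
  (* On skew matrices [skew_part] is inverted by [skew_part] itself, since the two sign changes
     cancel. *)
  exists (skew_part K).
    apply/symvP/matrixP => i j; rewrite !mxE Kij.
    by case: ltngtP => _; rewrite ?(mulr0n, mulr1n); ring.
  apply/matrixP => i j; rewrite lfunE !mxE.
  case: ltngtP => [_|_|ij]; rewrite ?(mulr0n, mulr1n); try ring.
  by have := Kij i j; rewrite (val_inj ij); lra.
pose dg := linfun (@diag_mx R r).
have ker : (symv r :&: lker L)%VS = limg dg.
  apply/vspaceP => S; rewrite memv_cap memv_ker lfunE.
  apply/andP/memv_imgP => [[/symvP symS /eqP/matrixP S0]|[d _ ->]].
    exists (\row_i S i i); rewrite ?memvf // lfunE; apply/matrixP => i j.
    have := S0 i j; rewrite !mxE; have [->|] := eqVneq i j; first by rewrite mulr1n.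
    by rewrite neq_ltn => /orP[] ij; rewrite ij ltnNge ltnW //= ?mulr0n ?mulr1n; lra.
  split; first by apply/symvP; rewrite lfunE tr_diag_mx.
  apply/eqP/matrixP => i j; rewrite lfunE !mxE.
  by have [->|] := eqVneq i j; rewrite ?ltnn ?mul0rn ?subrr ?mulr0n.
have dim_dg : \dim (limg dg) = r.
  rewrite limg_dim_eq ?dimvf /dim /= ?mul1n //.
  apply/eqP; rewrite -subv0; apply/subvP => d.
  rewrite memv_cap memv_ker lfunE memv0 => /andP[_ /eqP/matrixP d0].
  by apply/eqP/rowP => i; have := d0 i i; rewrite !mxE eqxx mulr1n.
have := limg_ker_dim L (symv r); rewrite ker img dim_dg.
have arith (a b q : nat) : (a + b = q -> r + a = b -> b.*2 = r + q)%N by lia.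
by rewrite mulnS; exact: arith.
Qed.

(** [Z] is the kernel in [V] of the pairings with a basis of [T]. Definiteness of the trace form
    makes these pairings injective on [T], so their rank on [V] is exactly [\dim T]. *)
Lemma dim_orthogonal r (V T : {vspace 'M[R]_r}) : (T <= V)%VS ->
  exists Z : {vspace 'M[R]_r},
    (forall S, S \in Z <-> S \in V /\ forall t, t \in T -> \tr (S *m t^T) = 0) /\
    (\dim Z + \dim T = \dim V)%N.
Proof.
move=> TV; pose f := linfun (frobenius_coords (vbasis T)).
have fP S : f S = 0 <-> forall t, t \in T -> \tr (S *m t^T) = 0.
  rewrite lfunE; split=> [/rowP S0 t tT|S0].
    rewrite (coord_vbasis tT) linear_sum mulmx_sumr raddf_sum big1 //= => i _.
    by rewrite linearZ -scalemxAr mxtraceZ; have := S0 i; rewrite !mxE => ->; rewrite mulr0.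
  apply/rowP => i; rewrite !mxE S0 //.
  by rewrite vbasis_mem ?mem_nth ?size_tuple.
exists (V :&: lker f)%VS; split.
  move=> S; rewrite memv_cap memv_ker; split.
    by move=> /andP[-> /eqP/fP].
  by move=> [-> /fP ->] /=.
have fT : \dim (f @: T) = \dim T.
  apply: limg_dim_eq; apply/eqP; rewrite -subv0; apply/subvP => S.
  rewrite memv_cap memv_ker memv0 => /andP[ST /eqP/fP/(_ _ ST) S0].
  by apply/eqP/mxtrace_sqr_eq0.
rewrite -(limg_ker_dim f V); congr (_ + _)%N; apply/eqP.
rewrite eqn_leq -{1}fT dimvS ?limgS //=.
by rewrite (leq_trans (dimvS (subvf _))) // dimvf /dim /= mul1n.
Qed.

End SymmetricSpace.

(** * From the full singular value decomposition to the one of size [\rank X] *)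

Section ReducedSVD.
Context {R : realType}.

Lemma singular_values_ge0 n m (X : 'M[R]_(n, m)) i : 0 <= singular_values X 0 i.
Proof.
rewrite mxE; set t := sort _ _; have [lt_it|le_ti] := ltnP i (size t).
  by have := mem_nth 0 lt_it; rewrite {2}/t mem_sort => /mapP[a _ ->]; exact: sqrtr_ge0.
by rewrite nth_default.
Qed.

Lemma singular_values_nonincreasing n m (X : 'M[R]_(n, m)) (i j : 'I_n) :
  (i <= j)%N -> singular_values X 0 j <= singular_values X 0 i.
Proof.
move=> le_ij; have := singular_values_ge0 X i; rewrite !mxE; set t := sort _ _ => ti0.
have [lt_jt|le_tj] := ltnP j (size t); last by rewrite nth_default.
have sort_t : sorted >=%R t by apply: sort_sorted => x y; apply: le_total.
apply: (sorted_leq_nth _ _ 0 sort_t) => //.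
- by move=> y x z xy yz; exact: le_trans yz xy.
- exact: lexx.
- exact: leq_ltn_trans le_ij lt_jt.
Qed.

Lemma first_cols_orthonormal n k (le_kn : (k <= n)%N) (U : 'M[R]_n) :
  orthogonal_mx U -> (first_cols le_kn U)^T *m first_cols le_kn U = 1%:M.
Proof.
move=> UU; apply/matrixP => i j.
have := congr1 (fun M : 'M[R]_n => M (widen_ord le_kn i) (widen_ord le_kn j)) UU.
rewrite !mxE => E; rewrite -[RHS]E.
by apply: eq_bigr => l _; rewrite !mxE.
Qed.

(** The first columns of the identity form the coordinate inclusion; multiplied by [U] or [V] they
    become the first columns of that matrix. *)
Lemma Diag_first_cols n m r (le_rn : (r <= n)%N) (le_rm : (r <= m)%N) (s : 'rV[R]_n) :
  (forall i : 'I_n, (r <= i)%N -> s 0 i = 0) ->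
  Diag m s = first_cols le_rn 1%:M *m diag_mx (\row_i s 0 (widen_ord le_rn i))
    *m (first_cols le_rm 1%:M)^T.
Proof.
move=> s0; apply/matrixP => i j; rewrite mul_mx_diag !mxE.
under eq_bigr do rewrite !mxE.
have [lt_ir|le_ri] := ltnP i r; last first.
  rewrite s0 // mul0rn big1 // => l _.
  have -> : i == widen_ord le_rn l = false.
    apply: contraTF (ltn_ord l) => /eqP e.
    by rewrite -leqNgt -[l : nat]/(widen_ord le_rn l : nat) -e.
  by rewrite !mul0r.
rewrite (bigD1 (Ordinal lt_ir)) //= big1 ?addr0 => [|l].
  have -> : widen_ord le_rn (Ordinal lt_ir) = i by apply: val_inj.
  by rewrite eqxx mul1r mulr_natr -val_eqE eq_sym.
rewrite -val_eqE /= => l_i; have -> : i == widen_ord le_rn l = false.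
  by rewrite -val_eqE /= eq_sym (negbTE l_i).
by rewrite !mul0r.
Qed.

Lemma rank_Diag n m (k : nat) (s : 'rV[R]_n) : (n <= m)%N -> (k <= n)%N ->
  (forall i : 'I_n, (s 0 i != 0) = (i < k)%N) -> \rank (Diag m s) = k.
Proof.
move=> le_nm le_kn sk.
(* Replacing the zero entries by 1 makes the diagonal factor invertible, and [pid_mx k] removes them
   again. *)
pose t : 'rV[R]_n := \row_i (if (i < k)%N then s 0 i else 1).
have -> : Diag m s = diag_mx t *m pid_mx k.
  apply/matrixP => i j; rewrite mul_diag_mx !mxE.
  have := sk i; case: ltnP => _; first by rewrite andbT mulr_natr.
  by move/negbFE/eqP ->; rewrite andbF mulr0 mul0rn.
have t_unit : diag_mx t \in unitmx.
  rewrite unitmxE det_diag unitfE; apply/prodf_neq0 => i _.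
  by rewrite mxE; case: ifP; rewrite ?oner_eq0 // sk.
rewrite eqmxMfull ?row_full_unit // rank_pid_mx //; exact: leq_trans le_nm.
Qed.

(** By monotonicity the nonzero singular values form an initial segment. Its length is the rank of
    the diagonal factor, and the invertible [U], [V] preserve it. *)
Lemma singular_values_rank n m (X : 'M[R]_(n, m)) (U : 'M[R]_n) (V : 'M[R]_m) i :
  (n <= m)%N -> orthogonal_mx U -> orthogonal_mx V ->
  X = U *m Diag m (singular_values X) *m V^T ->
  (singular_values X 0 i != 0) = (i < \rank X)%N.
Proof.
move=> le_nm UU VV XE.
pose P k := [forall j : 'I_n, (k <= j)%N ==> (singular_values X 0 j == 0)].
have exP : exists k, P k.
  by exists n; apply/forallP => j; rewrite leqNgt ltn_ord.
have [k Pk kmin] := ex_minnP exP.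
have le_kn : (k <= n)%N.
  by apply: kmin; apply/forallP => j; rewrite leqNgt ltn_ord.
have sk j : (singular_values X 0 j != 0) = (j < k)%N.
  apply/idP/idP => [|lt_jk].
    by apply: contraR; rewrite -leqNgt => le_kj; have /forallP/(_ j) := Pk; rewrite le_kj.
  apply: contraL lt_jk => /eqP sj0; rewrite -leqNgt; apply: kmin.
  apply/forallP => l; apply/implyP => le_jl.
  by rewrite eq_le singular_values_ge0 -sj0 singular_values_nonincreasing.
rewrite sk; congr (_ < _)%N.
have U_unit : U \in unitmx by case/mulmx1_unit: UU.
have V_free : row_free V^T by rewrite row_free_unit unitmx_tr; case/mulmx1_unit: VV.
rewrite XE mxrankMfree // eqmxMfull ?row_full_unit //.
by rewrite (rank_Diag le_nm le_kn sk).
Qed.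

Lemma reduced_svd n m (X : 'M[R]_(n, m)) (U : 'M[R]_n) (V : 'M[R]_m) :
  (n <= m)%N -> orthogonal_mx U -> orthogonal_mx V ->
  X = U *m Diag m (singular_values X) *m V^T ->
  exists s : 'rV[R]_(\rank X), (forall i, 0 < s 0 i) /\
  X = first_cols (rank_leq_row X) U *m diag_mx s *m (first_cols (rank_leq_col X) V)^T.
Proof.
move=> le_nm UU VV XE.
have sr i := singular_values_rank i le_nm UU VV XE.
exists (\row_i singular_values X 0 (widen_ord (rank_leq_row X) i)); split.
  by move=> i; rewrite mxE lt_def singular_values_ge0 sr /= ltn_ord.
rewrite {1}XE (Diag_first_cols (rank_leq_row X) (rank_leq_col X)); last first.
  by move=> i; rewrite leqNgt -sr negbK => /eqP.
by rewrite !mulmxA mulmx_colsub mulmx1 -mulmxA -trmx_mul mulmx_colsub mulmx1.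
Qed.

End ReducedSVD.

(** * Stability of strict positivity under small perturbations *)

Section Perturbation.
Context {R : realType}.

Lemma uniform_radius (I : finType) (P : I -> R -> Prop) :
  (forall i, exists2 e, 0 < e & forall t, `|t| <= e -> P i t) ->
  exists2 e, 0 < e & forall t, `|t| <= e -> forall i, P i t.
Proof.
move=> PI; suff [e e0 Pe] : exists2 e, 0 < e &
    forall t, `|t| <= e -> forall i, i \in enum I -> P i t.
  by exists e => // t te i; apply: Pe; rewrite ?mem_enum.
elim: (enum I) => [|i s [e e0 Pe]]; first by exists 1.
have [d d0 Pd] := PI i; exists (Num.min d e); first by rewrite lt_min d0.
move=> t; rewrite le_min => /andP[td te] j.
by rewrite inE => /orP[/eqP ->|js]; [exact: Pd|exact: Pe].
Qed.

(** Each [|p_i p_j|] is at most the mean of [p_i^2] and [p_j^2], hence at most [|p|^2]. *)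
Lemma quadratic_form_bound r (S : 'M[R]_r) (p : 'rV[R]_r) :
  `|(p *m S *m p^T) 0 0| <= (\sum_i \sum_j `|S i j|) * \sum_k p 0 k ^+ 2.
Proof.
have pk i : p 0 i ^+ 2 <= \sum_k p 0 k ^+ 2.
  by rewrite (bigD1 i) //= lerDl sumr_ge0 // => k _; rewrite sqr_ge0.
have -> : (p *m S *m p^T) 0 0 = \sum_j \sum_i p 0 i * S i j * p 0 j.
  by rewrite mxE; apply: eq_bigr => j _; rewrite !mxE mulr_suml.
rewrite exchange_big mulr_suml (le_trans (ler_norm_sum _ _ _)) //=.
apply: ler_sum => i _; rewrite mulr_suml (le_trans (ler_norm_sum _ _ _)) //=.
apply: ler_sum => j _; rewrite mulrAC normrM mulrC ler_wpM2l // ler_norml.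
by apply/andP; split; have := pk i; have := pk j; nra.
Qed.

Lemma psd_diag_perturbation r (s : 'rV[R]_r) (S : 'M[R]_r) :
  (forall i, 0 < s 0 i) -> S^T = S ->
  exists2 e, 0 < e & forall t, `|t| <= e -> psdmx (diag_mx s + t *: S).
Proof.
move=> s0 symS; pose c := \sum_i \sum_j `|S i j|.
have c0 : 0 <= c by apply: sumr_ge0 => i _; apply: sumr_ge0.
have [e e0 Pe] : exists2 e : R, 0 < e & forall t : R, `|t| <= e -> forall i, `|t| * c <= s 0 i.
  apply: (uniform_radius (P := fun i t => `|t| * c <= s 0 i)) => i.
  (* The added 1 keeps the denominator positive when [S = 0]. *)
  exists (s 0 i / (c + 1)) => [|t].
    by rewrite divr_gt0 ?s0 // ltr_wpDl.
  by rewrite ler_pdivlMr ?ltr_wpDl //; have := normr_ge0 t; nra.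
exists e => // t /Pe te; split; first by rewrite linearD /= linearZ /= symS tr_diag_mx.
move=> p; rewrite mulmxDr mulmxDl -scalemxAr -scalemxAl mxE [X in _ + X]mxE.
have -> : (p *m diag_mx s *m p^T) 0 0 = \sum_i s 0 i * p 0 i ^+ 2.
  by rewrite mxE; apply: eq_bigr => i _; rewrite mul_mx_diag !mxE; ring.
have bound : `|t * (p *m S *m p^T) 0 0| <= \sum_i s 0 i * p 0 i ^+ 2.
  rewrite normrM (le_trans (ler_wpM2l (normr_ge0 t) (quadratic_form_bound _ _))) //.
  rewrite mulrA mulr_sumr; apply: ler_sum => i _.
  by rewrite ler_wpM2r ?sqr_ge0 ?te.
by move: bound; rewrite ler_norml => /andP[]; lra.
Qed.

End Perturbation.

(** * The subgradient at [X] and the matrices at which it attains the norm *)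

Section ExposedFace.
Context {R : realType} {n m r : nat} {theta : R}.
Variables (X : 'M[R]_(n, m)) (A : 'M[R]_(n, r)) (B : 'M[R]_(m, r)).
Hypothesis theta0 : 0 < theta.
Hypothesis AA : A^T *m A = 1%:M.
Hypothesis BB : B^T *m B = 1%:M.

(** At a zero entry of [X] any sign value in [-1, 1] would give a subgradient; the value 0 makes the
    equality case force [Y] to vanish there. *)
Definition subgradient : 'M[R]_(n, m) := map_mx Num.sg X + theta *: (A *m B^T).

Lemma trace_subgradient Y : \tr (Y *m subgradient^T) =
  \sum_i \sum_j Num.sg (X i j) * Y i j + theta * \tr (Y *m (A *m B^T)^T).
Proof.
rewrite /subgradient linearD /= linearZ /= mulmxDr mxtraceD -scalemxAr mxtraceZ.
congr (_ + _); apply: eq_bigr => i _; rewrite mxE.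
by apply: eq_bigr => j _; rewrite !mxE mulrC.
Qed.

Lemma sg_mul_le (x y : R) : Num.sg x * y <= `|y|.
Proof.
rewrite (le_trans (ler_norm _)) // normrM ler_piMl // normr_sg.
by case: eqP => //; rewrite ?ler01.
Qed.

Lemma l1_nuclear_norm_dual Y : \tr (Y *m subgradient^T) <= l1_nuclear_norm theta Y.
Proof.
rewrite trace_subgradient lerD //.
  by apply: ler_sum => i _; apply: ler_sum => j _; exact: sg_mul_le.
rewrite ler_pM2l //; have [] // := nuclear_norm_dual Y (partial_isometry_contraction AA BB).
Qed.

Lemma l1_nuclear_norm_attainedP Y :
  \tr (Y *m subgradient^T) = l1_nuclear_norm theta Y <->
  (exists S, psdmx S /\ Y = A *m S *m B^T) /\
  (forall i j, `|Y i j| = Num.sg (X i j) * Y i j).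
Proof.
split=> [eqY|[[S [psdS YE]] sgY]].
  have l1_le : \sum_i \sum_j Num.sg (X i j) * Y i j <= l1_norm Y.
    by apply: ler_sum => i _; apply: ler_sum => j _; exact: sg_mul_le.
  have [nuc_le _] := nuclear_norm_dual Y (partial_isometry_contraction AA BB).
  move: eqY; rewrite trace_subgradient /l1_nuclear_norm => eqY.
  (* Both summands obey an inequality, so equality of the sums forces equality in each. *)
  have tr_eq : \tr (Y *m (A *m B^T)^T) = nuclear_norm Y.
    by apply/eqP; rewrite eq_le nuc_le /= -(ler_pM2l theta0); lra.
  rewrite tr_eq in eqY; move/addIr: eqY => eqY.
  split; first exact: nuclear_norm_face.
  have l1_eq : \sum_i \sum_j (`|Y i j| - Num.sg (X i j) * Y i j) = 0.
    under eq_bigr do rewrite sumrB.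
    by rewrite sumrB eqY subrr.
  have ge0 i j : 0 <= `|Y i j| - Num.sg (X i j) * Y i j by rewrite subr_ge0 sg_mul_le.
  move=> i j; apply/eqP; rewrite -subr_eq0; apply/eqP.
  move: j (erefl true); apply: psumr_eq0P => // .
  move: i (erefl true); apply: psumr_eq0P => // i _.
  by apply: sumr_ge0.
rewrite trace_subgradient /l1_nuclear_norm; congr (_ + theta * _).
  by apply: eq_bigr => i _; apply: eq_bigr => j _; rewrite sgY.
rewrite YE nuclear_norm_embed // trmx_mul trmxK !mulmxA -[_ *m B^T *m B]mulmxA BB mulmx1.
by rewrite mxtrace_mulC mulmxA AA mul1mx.
Qed.

End ExposedFace.

(** * Directions contained in every face through [X], and an upper bound for the minimal face *)

Section Faces.
Local Open Scope convex_scope.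
Local Open Scope ring_scope.
Context {R : realType} {n m r : nat} {theta : R}.
Variables (X : 'M[R]_(n, m)) (A : 'M[R]_(n, r)) (B : 'M[R]_(m, r)) (s : 'rV[R]_r).
Hypothesis theta0 : 0 < theta.
Hypothesis AA : A^T *m A = 1%:M.
Hypothesis BB : B^T *m B = 1%:M.
Hypothesis s0 : forall i, 0 < s 0 i.
Hypothesis XE : X = A *m diag_mx s *m B^T.

Let conv_lmodE (t : {i01 R}) (x y : convex_lmodType 'M[R]_(n, m)) :
  x <| t |> y = t%:num *: (x : 'M[R]_(n, m)) + (1 - t%:num) *: (y : 'M[R]_(n, m)).
Proof. by []. Qed.

Let G := @subgradient R n m r theta X A B.
Let Q := l1_nuclear_ball n m theta.

Lemma subgradient_base : \tr (X *m G^T) = l1_nuclear_norm theta X.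
Proof.
apply/l1_nuclear_norm_attainedP => //; split; last by move=> i j; rewrite normrEsg.
by exists (diag_mx s); split => //; apply: psd_diag => i; rewrite ltW.
Qed.

Lemma face_perturbation (F : set 'M[R]_(n, m)) (S : 'M[R]_r) :
  Q X -> face Q F -> F X -> S^T = S ->
  (forall i j, X i j = 0 -> (A *m S *m B^T) i j = 0) ->
  \tr (A *m S *m B^T *m G^T) = 0 ->
  exists2 e, 0 < e & F (X + e *: (A *m S *m B^T)).
Proof.
move DE: (A *m S *m B^T) => D QX [_ _ faceF] FX symS D0 trD0.
have [e1 e10 Pe1] := psd_diag_perturbation s0 symS.
have [e2 e20 Pe2] : exists2 e : R, 0 < e & forall t : R, `|t| <= e ->
    forall ij : 'I_n * 'I_m, 0 <= Num.sg (X ij.1 ij.2) * (X ij.1 ij.2 + t * D ij.1 ij.2).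
  apply: (uniform_radius (P := fun (ij : 'I_n * 'I_m) t =>
    0 <= Num.sg (X ij.1 ij.2) * (X ij.1 ij.2 + t * D ij.1 ij.2))) => -[i j] /=.
  have [X0|X0] := eqVneq (X i j) 0.
    by exists 1 => // t _; rewrite X0 sgr0 mul0r.
  (* Within this radius [|t D i j|] stays below [|X i j|], so the entry keeps its sign. *)
  exists (`|X i j| / (`|D i j| + 1)) => [|t].
    by rewrite divr_gt0 ?normr_gt0 // ltr_wpDl.
  rewrite ler_pdivlMr ?ltr_wpDl // => te.
  rewrite mulrDr -normrEsg.
  have : `|Num.sg (X i j) * (t * D i j)| <= `|t| * `|D i j|.
    by rewrite !normrM normr_sg X0 mul1r.
  rewrite ler_norml => /andP[+ _]; have := normr_ge0 t; nra.
pose e := Num.min e1 e2.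
have e0 : 0 < e by rewrite lt_min e10.
(* For such [t] the norm of [X + t D] is attained at [G], hence equals the trace against [G], which
   does not depend on [t]. *)
have Qt t : `|t| <= e -> Q (X + t *: D).
  rewrite le_min => /andP[te1 te2]; rewrite /Q /l1_nuclear_ball /=.
  have <- : \tr ((X + t *: D) *m G^T) = l1_nuclear_norm theta (X + t *: D).
    apply/l1_nuclear_norm_attainedP => //; split.
      exists (diag_mx s + t *: S); split; first exact: Pe1.
      by rewrite XE -DE mulmxDr mulmxDl -scalemxAr -scalemxAl.
    move=> i j; rewrite mxE [(t *: D) i j]mxE; have := Pe2 _ te2 (i, j) => /=.
    have [X0|X0] := eqVneq (X i j) 0.
      by rewrite X0 sgr0 !mul0r (D0 _ _ X0) mulr0 addr0 normr0.
    by move=> /ger0_norm <-; rewrite normrM normr_sg X0 mul1r.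
  by rewrite mulmxDl -scalemxAl mxtraceD mxtraceZ trD0 mulr0 addr0 subgradient_base.
exists e => //.
have convE (t : {i01 R}) : ((X + e *: D : convex_lmodType 'M[R]_(n, m)) <| t |> (X - e *: D))
    = X + ((2 * t%:num - 1) * e) *: D.
  by rewrite conv_lmodE; apply/matrixP => i j; rewrite !mxE; ring.
(* [X] is the midpoint of this segment of the ball, so the face contains the endpoint [X + e D]. *)
apply: (faceF (X + e *: D) (X - e *: D)).
- move=> _ [t _ <-]; rewrite convE; apply: Qt.
  have t0 : 0 <= t%:num by [].
  have t1 : t%:num <= 1 by [].
  rewrite normrM (gtr0_norm e0) ler_piMl ?(ltW e0) // ler_norml.
  by apply/andP; split; lra.
- exists X; split => //.
  have h0 : 0 <= 2^-1 :> R by rewrite invr_ge0.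
  have h1 : 2^-1 <= 1 :> R by lra.
  exists (Itv01 h0 h1); first by rewrite /= invr_gt0 ltr0n /=; lra.
  by rewrite convE /= mulfV ?pnatr_eq0 // subrr mul0r scale0r addr0.
- by exists 1%:i01 => //; exact: conv1.
Qed.

Lemma minimal_face_sub (F : set 'M[R]_(n, m)) Y :
  l1_nuclear_norm theta X = 1 -> minimal_face Q X F -> F Y ->
  \tr (Y *m G^T) = 1 /\ \tr (Y *m G^T) = l1_nuclear_norm theta Y.
Proof.
move=> fX1 [_ _ minF] FY.
(* The slice of the ball by a supporting hyperplane through [X]; by minimality it is enough that it
   is a face. *)
pose F1 : set 'M[R]_(n, m) := [set Z : 'M[R]_(n, m) | Q Z /\ \tr (Z *m G^T) = 1]%classic.
have F1E Z : F1 Z -> \tr (Z *m G^T) = l1_nuclear_norm theta Z.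
  move=> [QZ Z1]; apply/eqP; rewrite eq_le l1_nuclear_norm_dual //= Z1.
  exact: QZ.
have trconv (t : {i01 R}) (Z1 Z2 : convex_lmodType 'M[R]_(n, m)) :
    \tr ((Z1 <| t |> Z2) *m G^T) = t%:num * \tr ((Z1 : 'M[R]_(n, m)) *m G^T)
      + (1 - t%:num) * \tr ((Z2 : 'M[R]_(n, m)) *m G^T).
  by rewrite conv_lmodE mulmxDl -!scalemxAl mxtraceD !mxtraceZ.
suff faceF1 : face Q F1.
  have F1X : F1 X by split; rewrite ?subgradient_base // /Q /l1_nuclear_ball /= fX1.
  by have F1Y := minF _ faceF1 F1X Y FY; split; [exact: F1Y.2|exact: F1E].
split.
- move=> y z t; rewrite !inE => yF1 zF1.
  have tr1 : \tr ((y <| t |> z) *m G^T) = 1.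
    by rewrite trconv yF1.2 zF1.2; ring.
  split => //; rewrite /Q /l1_nuclear_ball /= -tr1.
  have [[Sy [psdy yE]] sgy] := (l1_nuclear_norm_attainedP X theta0 AA BB y).1 (F1E _ yF1).
  have [[Sz [psdz zE]] sgz] := (l1_nuclear_norm_attainedP X theta0 AA BB z).1 (F1E _ zF1).
  (* The combination stays in the ball because the conditions for attaining the norm at [G] survive
     convex combination, so its norm is its trace against [G], namely 1. *)
  rewrite le_eqVlt eq_sym; apply/orP; left; apply/eqP.
  have t0 : 0 <= t%:num by [].
  have t1 : 0 <= 1 - t%:num by rewrite subr_ge0.
  apply/l1_nuclear_norm_attainedP => //; split.
    exists (t%:num *: Sy + (1 - t%:num) *: Sz); split; first exact: psd_comb.
    by rewrite conv_lmodE yE zE mulmxDr mulmxDl -!scalemxAr -!scalemxAl.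
  move=> i j; apply/eqP; rewrite eq_le sg_mul_le andbT.
  have -> : (y <| t |> z) i j = t%:num * (y : 'M[R]_(n, m)) i j
      + (1 - t%:num) * (z : 'M[R]_(n, m)) i j by rewrite conv_lmodE !mxE.
  rewrite (le_trans (ler_normD _ _)) // !normrM (ger0_norm t0) (ger0_norm t1).
  by rewrite sgy sgz mulrDr ![Num.sg _ * (_ * _)]mulrCA.
- by move=> y [].
move=> y z sub [w [[t /= /andP[t0 t1] <-] [Qw w1]]] _ [u _ <-].
split; first by apply: sub; exists u.
have Qy : \tr ((y : 'M[R]_(n, m)) *m G^T) <= 1.
  apply: le_trans (l1_nuclear_norm_dual X theta0 AA BB y) _.
  by apply: sub; exists 1%:i01 => //; exact: conv1.
have Qz : \tr ((z : 'M[R]_(n, m)) *m G^T) <= 1.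
  apply: le_trans (l1_nuclear_norm_dual X theta0 AA BB z) _.
  by apply: sub; exists 0%:i01 => //; exact: conv0.
move: w1; rewrite !trconv => w1.
(* Two numbers at most 1 whose average with positive weights is 1 are both 1. *)
have [-> ->] : \tr ((y : 'M[R]_(n, m)) *m G^T) = 1 /\ \tr ((z : 'M[R]_(n, m)) *m G^T) = 1.
  by split; nra.
by ring.
Qed.

End Faces.

(** * The direction space and its dimension *)

Section Directions.
Context {R : realType}.

Lemma trace_double_sym_part r (S M : 'M[R]_r) : S^T = S ->
  \tr (S *m (double_sym_part M)^T) = 2 * \tr (S *m M^T).
Proof.
move=> symS; rewrite /double_sym_part linearD /= trmxK mulmxDr mxtraceD.
have -> : \tr (S *m M) = \tr (S *m M^T).
  by rewrite -mxtrace_tr trmx_mul symS mxtrace_mulC.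
by ring.
Qed.

Lemma double_sym_part_symv r (M : 'M[R]_r) : double_sym_part M \in symv r.
Proof. by apply/symvP; rewrite /double_sym_part linearD /= trmxK addrC. Qed.

Lemma sym_outerE n m r (A : 'M[R]_(n, r)) (B : 'M[R]_(m, r)) ij :
  sym_outer A B ij = double_sym_part ((row ij.1 A)^T *m row ij.2 B).
Proof. by rewrite /double_sym_part trmx_mul trmxK. Qed.

(** Turns the vanishing of an entry of [A S B^T] into orthogonality of [S] to a [sym_outer]
    matrix. *)
Lemma trace_sym_outer n m r (A : 'M[R]_(n, r)) (B : 'M[R]_(m, r)) (S : 'M[R]_r) ij :
  S^T = S -> \tr (S *m (sym_outer A B ij)^T) = 2 * (A *m S *m B^T) ij.1 ij.2.
Proof.
move=> symS; rewrite sym_outerE trace_double_sym_part // trmx_mul trmxK mulmxA.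
rewrite mxtrace_mulC mulmxA -row_mul trace_mx11.
by rewrite !mxE; congr (_ * _); apply: eq_bigr => k _; rewrite !mxE.
Qed.

Lemma dim_cons_span (E : vectType R) (v : E) (T : {vspace E}) :
  v \notin T -> \dim (<[v]> + T) = (\dim T).+1.
Proof.
move=> vT; have v0 : v != 0 by apply: contraNneq vT => ->; rewrite mem0v.
rewrite dimv_disjoint_sum ?dim_vline ?v0 //.
apply/eqP; rewrite -subv0; apply/subvP => x.
rewrite memv_cap memv0 => /andP[/vlineP[k ->]]; have [->|k0] := eqVneq k 0.
  by rewrite scale0r.
by move/(memvZ k^-1); rewrite scalerA mulVf // scale1r (negbTE vT).
Qed.

Lemma trace_span_eq0 r (S : 'M[R]_r) (X : seq 'M[R]_r) :
  (forall x, x \in X -> \tr (S *m x^T) = 0) ->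
  forall t, t \in <<X>>%VS -> \tr (S *m t^T) = 0.
Proof.
move=> SX t tX; rewrite (coord_span (X := in_tuple X) tX).
rewrite linear_sum mulmx_sumr raddf_sum big1 //= => i _.
by rewrite linearZ -scalemxAr mxtraceZ SX ?mulr0 // mem_nth.
Qed.

(* [L] consists of the directions along which the norm is affine near [X]. *)
Lemma direction_space n m r (X G : 'M[R]_(n, m)) (A : 'M[R]_(n, r)) (B : 'M[R]_(m, r))
    (S0 : 'M[R]_r) :
  A^T *m A = 1%:M -> B^T *m B = 1%:M -> S0^T = S0 -> X = A *m S0 *m B^T ->
  \tr (X *m G^T) != 0 ->
  exists L : {vspace 'M[R]_(n, m)},
    ((\dim L).+1 + \dim <<[seq sym_outer A B ij | ij in zero_entries X]>>%VS).*2
      = (r * r.+1)%N /\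
    forall D, D \in L <-> exists S, [/\ D = A *m S *m B^T, S^T = S,
      forall i j, X i j = 0 -> D i j = 0 & \tr (D *m G^T) = 0].
Proof.
move=> AA BB symS0 XE trX.
set T := <<_>>%VS; pose Gs := double_sym_part (A^T *m G *m B).
(* For symmetric [S], orthogonality of [A S B^T] to [G] is orthogonality of [S] to [Gs]. *)
have trGs S : S^T = S -> \tr (S *m Gs^T) = 2 * \tr (A *m S *m B^T *m G^T).
  move=> symS; rewrite trace_double_sym_part //; congr (_ * _).
  by rewrite !trmx_mul trmxK !mulmxA mxtrace_mulC !mulmxA.
have trT S : S^T = S -> (forall t, t \in T -> \tr (S *m t^T) = 0) <->
    (forall i j, X i j = 0 -> (A *m S *m B^T) i j = 0).
  move=> symS; split=> [ST i j Xij|SX].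
    have tT : sym_outer A B (i, j) \in T.
      by apply/memv_span/mapP; exists (i, j) => //; rewrite mem_enum inE /= Xij.
    have /eqP := ST _ tT; rewrite trace_sym_outer // mulf_eq0 pnatr_eq0 /=.
    by move/eqP.
  apply: trace_span_eq0 => x /mapP[[i j]]; rewrite mem_enum inE /= => /eqP Xij ->.
  by rewrite trace_sym_outer //= SX // mulr0.
have TG : Gs \notin T.
  apply: contra trX => GsT; apply/eqP.
  have : \tr (S0 *m Gs^T) = 0 by apply: ((trT _ symS0).2 _ _ GsT); rewrite -XE.
  by rewrite trGs // -XE => /eqP; rewrite mulf_eq0 pnatr_eq0 /= => /eqP.
have subT : (<[Gs]> + T <= symv r)%VS.
  rewrite subv_add -memvE double_sym_part_symv /=; apply/span_subvP => _ /mapP[ij _ ->].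
  by rewrite sym_outerE double_sym_part_symv.
have [Z [ZP dimZ]] := dim_orthogonal subT.
pose f := linfun (mulmxr B^T \o mulmx A).
have fE S : f S = A *m S *m B^T by rewrite lfunE.
exists (f @: Z)%VS; split.
  (* The map from [S] to [A S B^T] is injective, with left inverse given by [A^T] and [B], so [L]
     has the dimension of [Z]. *)
  rewrite limg_dim_eq; last first.
    apply/eqP; rewrite -subv0; apply/subvP => S; rewrite memv_cap memv_ker memv0 fE.
    move=> /andP[_ /eqP S00]; apply/eqP.
    have -> : S = A^T *m (A *m S *m B^T) *m B.
      by rewrite !mulmxA AA mul1mx -mulmxA BB mulmx1.
    by rewrite S00 mulmx0 mul0mx.
  have := @dim_symv R r; rewrite -dimZ dim_cons_span // => <-.
  by rewrite addSnnS.
move=> D; split=> [/memv_imgP[S SZ ->]|[S [-> symS DX trD]]]; rewrite ?fE.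
  have [/symvP symS ST] := (ZP S).1 SZ.
  exists S; split => //.
    by apply/(trT _ symS) => t tT; apply: ST; apply: subvP tT; exact: addvSr.
  have GsT : Gs \in (<[Gs]> + T)%VS by apply: (subvP (addvSl _ _)); exact: memv_line.
  have /eqP := ST _ GsT; rewrite trGs // mulf_eq0 pnatr_eq0 /=.
  by move/eqP.
rewrite -fE; apply/memv_img/ZP; split; first exact/symvP.
move=> _ /memv_addP[_ /vlineP[k ->] [t tT ->]].
rewrite linearD /= linearZ /= mulmxDr mxtraceD -scalemxAr mxtraceZ trGs // trD.
by rewrite ((trT _ symS).2 DX) // !mulr0 addr0.
Qed.

End Directions.

(** The dimension formula is stated for norm 1: at a point of smaller norm the minimal face is the
    whole ball, of dimension [n * m], and the formula fails. The final inequality covers both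
    cases. *)
Theorem theorem3p2 (R : realType) (n m : nat) (theta : R)
    (X : 'M[R]_(n, m)) (U : 'M[R]_n) (V : 'M[R]_m) :
  (n <= m)%N -> 0 < theta ->
  X != 0 -> l1_nuclear_ball n m theta X ->
  orthogonal_mx U -> orthogonal_mx V ->
  X = U *m Diag m (singular_values X) *m V^T ->
  let r := \rank X in
  let Uhat := first_cols (rank_leq_row X) U in
  let Vhat := first_cols (rank_leq_col X) V in
  let I := zero_entries X in
  (l1_nuclear_norm theta X = 1 ->
   forall F : set 'M[R]_(n, m),
     minimal_face (l1_nuclear_ball n m theta) X F ->
     (r%:R * (r%:R + 1) - 2) / 2
       - (\dim <<[seq sym_outer Uhat Vhat ij | ij in I]>>%VS)%:R
     = (affine_dim F)%:R :> R) /\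
  (forall F : set 'M[R]_(n, m),
     face (l1_nuclear_ball n m theta) F -> F X ->
     r%:R * (r%:R + 1) / 2 - #|I|%:R <= (affine_dim F)%:R + 1 :> R).
Proof.
move=> le_nm theta0 X0 QX UU VV XE r Uhat Vhat I.
have AA := first_cols_orthonormal (rank_leq_row X) UU.
have BB := first_cols_orthonormal (rank_leq_col X) VV.
have [s [s0 sXE]] := reduced_svd le_nm UU VV XE.
rewrite -/Uhat -/Vhat in AA BB sXE.
pose G := @subgradient R n m r theta X Uhat Vhat.
have psds : psdmx (diag_mx s) by apply: psd_diag => i; rewrite ltW.
have trX := subgradient_base theta0 AA BB s0 sXE.
have trX_gt0 : 0 < \tr (X *m G^T).
  (* The entrywise part of the norm is already positive, as [X] has a nonzero entry. *)
  rewrite trX ltr_pwDl //; last first.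
    by apply: mulr_ge0; [exact: ltW|apply: sumr_ge0 => i _; exact: singular_values_ge0].
  rewrite lt_def /l1_norm sumr_ge0 ?andbT => [|i _]; last by rewrite sumr_ge0.
  apply: contraNneq X0 => l10; apply/eqP/matrixP => i j; rewrite mxE; apply/eqP.
  rewrite -normr_eq0; apply/eqP; move: j (erefl true); apply: psumr_eq0P => //.
  move: i (erefl true); apply: psumr_eq0P => // i _; exact: sumr_ge0.
have [L [dimL LP]] := direction_space AA BB psds.1 sXE (lt0r_neq0 trX_gt0).
(* [W] is the direction space of [F]: it contains [L] for every face through [X], and equals [L]
   when [F] lies in [X + L]. *)
have face_dim F : face (l1_nuclear_ball n m theta) F -> F X ->
    exists W : {vspace 'M[R]_(n, m)}, [/\ affine_dim F = \dim W, (L <= W)%VS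
      & (forall Y, F Y -> Y - X \in L) -> W = L].
  move=> faceF FX; have [W [dimW FW Wmin]] := affine_dim_directions FX.
  have LW : (L <= W)%VS.
    apply/subvP => D /LP[S [DE symS DX trD]]; rewrite DE in DX trD *.
    have [e e0 Fe] := face_perturbation theta0 AA BB s0 sXE QX faceF FX symS DX trD.
    have := FW _ Fe; rewrite addrC addKr => /(memvZ e^-1).
    by rewrite scalerA mulVf ?gt_eqF // scale1r.
  exists W; split => // FL; apply/eqP; rewrite eqEsubv LW andbT; exact: Wmin.
have dimR : ((\dim L)%:R + 1 + (\dim <<[seq sym_outer Uhat Vhat ij | ij in I]>>%VS)%:R) * 2
    = r%:R * (r%:R + 1) :> R.
  by rewrite !natr1 -natrD -!natrM muln2 dimL.
split=> [f1 F minF|F faceF FX].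
  have [faceF FX _] := minF.
  have [W [-> _ ->]] := face_dim F faceF FX; first by lra.
  move=> Y FY; apply/LP.
  have [Y1 Yf] := minimal_face_sub theta0 AA BB s0 sXE f1 minF FY.
  have [[S [psdS YE]] sgY] := (l1_nuclear_norm_attainedP X theta0 AA BB Y).1 Yf.
  exists (S - diag_mx s); split.
  - by rewrite mulmxBr mulmxBl -YE -sXE.
  - by rewrite linearB /= psdS.1 tr_diag_mx.
  - move=> i j Xij; rewrite !mxE Xij subr0; apply/eqP.
    by rewrite -normr_eq0 sgY Xij sgr0 mul0r.
  - by rewrite mulmxBl linearB /= Y1 trX f1 subrr.
have [W [-> /dimvS LW _]] := face_dim F faceF FX.
(* Each zero entry contributes one generator, so it lowers [\dim L] by at most one. *)
have dimI : (\dim <<[seq sym_outer Uhat Vhat ij | ij in I]>>%VS <= #|I|)%N.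
  by rewrite (leq_trans (dim_span _)) // size_map -cardE.
move: LW dimI; rewrite -(ler_nat R) -[(_ <= #|I|)%N](ler_nat R); lra.
Qed.
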